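(* Let $n > k \geq 1$ be integers. Then ${\tt vdw}(n,k)$ is a pseudo-manifold if and only if one of the following holds: (1) $k = 1$ and $n = 2$ or $3$; or (2) $k = 2$ and $n = 3, 4, 5$, or $6$; or (3) $k \geq 3$ and $\frac{n}{2} \leq k < n$.
   Context: For integers $n > k \geq 1$, the van der Waerden complex ${\tt vdw}(n,k)$ is the simplicial complex on the vertex set $\{x_1,\ldots,x_n\}$ whose facets are exactly the sets $\{x_i, x_{i+d}, x_{i+2d}, \ldots, x_{i+kd}\}$ with $i \geq 1$, $d \geq 1$ integers and $i+kd \leq n$. It is a pure complex of dimension $k$ (the dimension of a face $F$ is $|F|-1$; the empty set has dimension $-1$). A $k$-dimensional simplicial complex is a pseudo-manifold if: (1) it is pure (all facets have the same dimension); (2) every $(k-1)$-dimensional face is contained in at most two facets; and (3) given any two facets $F_a, F_b$, there is a sequence of facets $F_a = G_0, G_1, \ldots, G_m = F_b$ such that $G_i \cap G_{i+1}$ has dimension $k-1$ for all $0 \leq i \leq m-1$. *)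

(* Defs.v *)
From mathcomp Require Import all_boot all_order all_algebra.

Set Implicit Arguments.
Unset Strict Implicit.
Unset Printing Implicit Defensive.

Import Order.TTheory GRing.Theory Num.Theory.

(* The void complex, without any face, is allowed; every other complex
   contains the empty face. *)
Record complex (V : finType) := Complex {
  faces :> {set {set V}};
  _ : forall F G : {set V}, F \in faces -> G \subset F -> G \in faces
}.

Definition dim (V : finType) (F : {set V}) : int := (#|F|%:Z - 1)%R.

Definition complex_dim (V : finType) (D : complex V) : int :=
  \big[Order.max/(-1)%R]_(F in faces D) dim F.

Definition facets (V : finType) (D : complex V) : {set {set V}} :=
  [set F in faces D | [forall G in faces D, (F \subset G) ==> (G == F)]].

Definition pure (V : finType) (D : complex V) : Prop :=
  forall F G : {set V}, F \in facets D -> G \in facets D -> dim F = dim G.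

(* In the third clause, the sequence of facets is Fa :: s. *)
Definition pseudo_manifold (V : finType) (D : complex V) : Prop :=
  [/\ pure D,
      forall F : {set V}, F \in faces D -> dim F = (complex_dim D - 1)%R ->
        #|[set G in facets D | F \subset G]| <= 2
    & forall Fa Fb : {set V}, Fa \in facets D -> Fb \in facets D ->
        exists s : seq {set V},
          [/\ all [in facets D] s,
              path (fun G H => dim (G :&: H) == (complex_dim D - 1)%R) Fa s
            & last Fa s = Fb]].

Definition generated_faces (V : finType) (S : {set {set V}}) : {set {set V}} :=
  [set F : {set V} | [exists A in S, F \subset A]].

Fact generated_faces_closed (V : finType) (S : {set {set V}}) (F G : {set V}) :
  F \in generated_faces S -> G \subset F -> G \in generated_faces S.
Proof.
rewrite !inE => /existsP[A /andP[AS FA]] GF.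
by apply/existsP; exists A; rewrite AS (subset_trans GF FA).
Qed.

Definition generated_complex (V : finType) (S : {set {set V}}) : complex V :=
  Complex (@generated_faces_closed V S).

(* The vertex x_m, for 1 <= m <= n, is the ordinal of value m - 1. *)
Definition progression (n k i d : nat) : {set 'I_n} :=
  [set x : 'I_n | [exists j : 'I_k.+1, x.+1 == i + j * d]].

(* Bounding i and d by n loses nothing when 1 <= k: see progressionsP. *)
Definition progressions (n k : nat) : {set {set 'I_n}} :=
  [set A | [exists i : 'I_n.+1, exists d : 'I_n.+1,
     [&& 1 <= i, 1 <= d, i + k * d <= n & A == progression n k i d]]].

Definition vdw (n k : nat) : complex 'I_n :=
  generated_complex (progressions n k).

Lemma progressionsP (n k : nat) (A : {set 'I_n}) : 1 <= k ->
  reflect (exists i d : nat,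
             [/\ 1 <= i, 1 <= d, i + k * d <= n & A = progression n k i d])
          (A \in progressions n k).
Proof.
move=> k1; rewrite inE; apply: (iffP existsP) => [[i /existsP[d]]|].
  by case/and4P=> i1 d1 le /eqP->; exists i, d.
move=> [i [d [i1 d1 le ->]]].
have li : i < n.+1 by rewrite ltnS (leq_trans (leq_addr _ _) le).
have ld : d < n.+1.
  rewrite ltnS (leq_trans _ le) // (leq_trans _ (leq_addl _ _)) //.
  by rewrite leq_pmull.
exists (Ordinal li); apply/existsP; exists (Ordinal ld).
by rewrite /= i1 d1 le eqxx.
Qed.

Lemma card_progression (n k i d : nat) :
  1 <= i -> 1 <= d -> i + k * d <= n -> #|progression n k i d| = k.+1.
Proof.
move=> i1 d1 le.
have bnd (j : 'I_k.+1) : (i + j * d).-1 < n.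
  rewrite prednK ?addn_gt0 ?i1 // (leq_trans _ le) // leq_add2l leq_mul2r.
  by rewrite -ltnS ltn_ord orbT.
have bndK (j : 'I_k.+1) : (i + j * d).-1.+1 = i + j * d.
  by rewrite prednK // addn_gt0 i1.
pose f j := Ordinal (bnd j).
have -> : progression n k i d = [set f j | j in [set: 'I_k.+1]].
  apply/setP=> x; rewrite inE; apply/existsP/imsetP=> [[j /eqP xj]|[j _ ->]].
    by exists j => //; apply: val_inj; rewrite /= -xj.
  by exists j; rewrite /= bndK.
rewrite card_imset ?cardsT ?card_ord // => j1 j2 /(congr1 val)/(congr1 S) /=.
rewrite !bndK => /addnI/eqP; rewrite eqn_pmul2r // => /eqP.
exact: val_inj.
Qed.

Lemma facets_vdw (n k : nat) : 1 <= k -> facets (vdw n k) = progressions n k.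
Proof.
move=> k1.
have cA A : A \in progressions n k -> #|A| = k.+1.
  by case/(progressionsP _ k1)=> i [d [i1 d1 le ->]]; apply: card_progression.
apply/setP=> F; rewrite 2!inE; apply/andP/idP.
  case=> /existsP[A /andP[AS FA]] /forallP/(_ A).
  rewrite FA implyTb => /implyP H; suff /eqP <- : A == F by [].
  by apply: H; rewrite inE; apply/existsP; exists A; rewrite AS subxx.
move=> FS; split; first by apply/existsP; exists F; rewrite FS subxx.
apply/forallP=> G; apply/implyP; rewrite inE => /existsP[A /andP[AS GA]].
apply/implyP=> FG; rewrite eq_sym eqEcard FG.
by rewrite (cA _ FS) -(cA _ AS) subset_leq_card.
Qed.

(* Main.v *)
Require Import Defs.
From mathcomp Require Import all_boot all_order all_algebra.
From mathcomp Require Import zify.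

(** The facets of vdw(n,k) are the progressions with k+1 terms, so the complex
    is pure of dimension k, and two distinct facets are adjacent when they
    share k vertices.

    If n <= 2k, every facet is an interval of k+1 consecutive vertices.
    Consecutive intervals share k vertices, which gives connectedness; and k
    vertices cannot lie in two intervals whose first terms differ by 2 or more
    ([card_two_intervals]), so they lie in at most two facets.  The other pairs
    on the list, (n,k) = (3,1), (5,2) and (6,2), have in addition facets of
    difference 2; since k <= 2, hence 2(k-1) <= k, the facet
    {i, i+2, ..., i+2k} shares its first k vertices with the interval from i to
    i+k, so connectedness persists ([linked_vdw]); the second condition is a finite count.

    Conversely, when k >= 3 an interval of k+1 integers meets a progression of
    difference at least 2 in fewer than k vertices ([card_interval_progression]).
    So no path of adjacent facets leaves the set of intervals, whereas n > 2k
    provides the facet {1, 3, ..., 2k+1}.  For k = 1 and n >= 4 the vertex 1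
    lies in three edges; for k = 2 and n >= 7 the edge {3,5} lies in 345, 135
    and 357. *)

(** * Progressions as sets of vertices *)

(** The terms of the progression, as a list of numbers that can be computed
    with; vertices are still numbered from 1. *)
Definition terms (k i d : nat) : seq nat := [seq i + j * d | j <- iota 0 k.+1].

Lemma termsP (k i d m : nat) :
  reflect (exists2 j, j <= k & m = i + j * d) (m \in terms k i d).
Proof.
apply: (iffP mapP) => [[j]|[j jk ->]]; last by exists j; rewrite // mem_iota.
by rewrite mem_iota /= add0n ltnS => jk ->; exists j.
Qed.

Lemma mem_progression (n k i d : nat) (x : 'I_n) :
  (x \in progression n k i d) = (x.+1 \in terms k i d).
Proof.
rewrite inE; apply/existsP/termsP => [[j /eqP e]|[j jk e]].
  by exists j => //; rewrite -ltnS.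
by exists (Ordinal (jk : j < k.+1)); rewrite /= e.
Qed.

Lemma mem_interval (n k i : nat) (x : 'I_n) :
  (x \in progression n k i 1) = (i <= x.+1 <= i + k).
Proof.
rewrite mem_progression; apply/termsP/idP => [[j]|]; first by lia.
by move=> h; exists (x.+1 - i); lia.
Qed.

Lemma sub_progression (n k i d k' i' d' : nat) :
  {subset terms k i d <= terms k' i' d'} ->
  progression n k i d \subset progression n k' i' d'.
Proof. by move=> h; apply/subsetP => x; rewrite !mem_progression => /h. Qed.

Lemma progression_neq (n k i d i' d' m : nat) : 0 < m <= n ->
  (m \in terms k i d) != (m \in terms k i' d') ->
  progression n k i d != progression n k i' d'.
Proof.
case: m => // m mn; apply: contraNN => /eqP e.
by have := mem_progression n k i d (Ordinal mn); rewrite e mem_progression /= => ->.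
Qed.

Lemma progression_in (n k i d : nat) : 1 <= k -> 1 <= i -> 1 <= d ->
  i + k * d <= n -> progression n k i d \in facets (vdw n k).
Proof. by move=> *; rewrite facets_vdw //; apply/progressionsP=> //; exists i, d. Qed.

Lemma facetP (n k : nat) (A : {set 'I_n}) : 1 <= k -> A \in facets (vdw n k) ->
  exists i d, [/\ 1 <= i, 1 <= d, i + k * d <= n & A = progression n k i d].
Proof. by move=> k1; rewrite facets_vdw // => /(progressionsP _ k1). Qed.

Lemma card_facet (n k : nat) (A : {set 'I_n}) :
  1 <= k -> A \in facets (vdw n k) -> #|A| = k.+1.
Proof. by move=> k1 /(facetP _ _ _ k1) [i [d [*]]]; subst; apply: card_progression. Qed.

Lemma complex_dim_vdw (n k : nat) : 1 <= k -> k < n ->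
  complex_dim (vdw n k) = Posz k.
Proof.
move=> k1 kn; apply/eqP; rewrite Order.POrderTheory.eq_le; apply/andP; split.
  apply: Order.POrderTheory.bigmax_le => // F.
  rewrite inE => /existsP[A /andP[AS FA]].
  have cA : #|A| = k.+1 by apply: (card_facet n k) => //; rewrite facets_vdw.
  have : #|F| <= k.+1 by rewrite -cA; apply: subset_leq_card.
  by rewrite /Defs.dim; case: #|F| => [|m]; lia.
have F1 : progression n k 1 1 \in facets (vdw n k).
  by apply: progression_in => //; lia.
have -> : Posz k = Defs.dim (progression n k 1 1).
  by rewrite /Defs.dim (card_facet _ _ _ k1 F1); lia.
by apply: Order.TotalTheory.le_bigmax_cond; move: F1; rewrite inE => /andP[].
Qed.

Lemma dim_ridge (n k : nat) (F : {set 'I_n}) : 1 <= k -> k < n ->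
  (Defs.dim F == complex_dim (vdw n k) - 1)%R = (#|F| == k).
Proof. by move=> k1 kn; rewrite complex_dim_vdw // /Defs.dim; lia. Qed.

(** * Counting vertices of intervals *)

Lemma card_le_inj {T : finType} (A : {set T}) (f : T -> nat) (m : nat) :
  {in A &, injective f} -> {in A, forall x, f x < m} -> #|A| <= m.
Proof.
move=> finj fm; rewrite cardE -(size_map f) -(size_iota 0 m).
apply: uniq_leq_size => [|_ /mapP[x xA ->]].
  rewrite map_inj_in_uniq ?enum_uniq // => x y.
  by rewrite !mem_enum; apply: finj.
by rewrite mem_iota fm // -mem_enum.
Qed.

Lemma card_two_intervals (n k i j : nat) (F : {set 'I_n}) : 1 <= k ->
  F \subset progression n k i 1 -> F \subset progression n k j 1 ->
  i.+1 < j -> #|F| < k.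
Proof.
move=> k1 /subsetP Fi /subsetP Fj ij.
suff : #|F| <= k.-1 by lia.
(* F lies in the interval from j to i + k *)
have FF x : x \in F -> j <= x.+1 <= i + k.
  by move=> xF; have := Fi x xF; have := Fj x xF; rewrite !mem_interval; lia.
apply: (card_le_inj _ (fun x : 'I_n => x.+1 - j)) => [x y /FF hx /FF hy e|x /FF].
  by apply: val_inj => /=; lia.
by lia.
Qed.

(** Distinct terms of a progression of difference at least 2 in the interval
    from i to i+k have distinct integer parts of (x - i)/2, which are at most
    k/2; so there are at most k/2 + 1 < k of them. *)
Lemma card_interval_progression (n k i a d : nat) : 2 < k -> 1 < d ->
  #|progression n k i 1 :&: progression n k a d| < k.
Proof.
move=> k3 d2; apply: (@leq_ltn_trans (k./2).+1); last by lia.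
apply: (card_le_inj _ (fun x : 'I_n => (x.+1 - i)./2)) => [x y|x]; last first.
  by rewrite in_setI mem_interval => /andP[? _]; lia.
rewrite !in_setI !mem_interval !mem_progression.
move=> /andP[hx /termsP[j _ ex]] /andP[hy /termsP[l _ ey]] e.
apply: val_inj => /=; case: (ltngtP j l) => jl; first by nia.
  by nia.
by subst l; lia.
Qed.

(** * Connectedness by adjacent facets *)

(** Adjacency of facets of vdw(n,k) (for 1 <= k < n), a facet being adjacent to
    itself; the loops do not change which facets are connected. *)
Definition adj (n k : nat) : rel {set 'I_n} := fun G H =>
  [&& G \in facets (vdw n k), H \in facets (vdw n k) & k <= #|G :&: H|].

Lemma adj_connect_sym (n k : nat) : connect_sym (adj n k).
Proof. by apply: sym_connect_sym => G H; rewrite /adj setIC andbCA. Qed.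

Lemma connect_facets (n k : nat) (Fa Fb : {set 'I_n}) : 1 <= k -> k < n ->
  connect (adj n k) Fa Fb ->
  exists s : seq {set 'I_n},
    [/\ all [in facets (vdw n k)] s,
        path (fun G H => Defs.dim (G :&: H) == complex_dim (vdw n k) - 1)%R Fa s
      & last Fa s = Fb].
Proof.
move=> k1 kn /connectP[s]; elim: s Fa => [|G s IH] Fa /=.
  by move=> _ ->; exists [::].
case/andP=> /and3P[fa fG kc] ps lst.
have [t [at_ pt lt]] := IH _ ps lst.
have [<-|neq] := eqVneq G Fa; first by exists t.
exists (G :: t); rewrite /= fG at_ pt lt dim_ridge //; split=> //.
rewrite andbT eqn_leq kc andbT -ltnS -(card_facet _ _ _ k1 fa).
apply: proper_card; rewrite properE subsetIl subsetI subxx /=.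
apply: contra neq => FG.
by rewrite eq_sym eqEcard FG (card_facet _ _ _ k1 fa) (card_facet _ _ _ k1 fG) /=.
Qed.

Lemma intervals_connected (n k i : nat) : 1 <= k -> 1 <= i -> i + k <= n ->
  connect (adj n k) (progression n k 1 1) (progression n k i 1).
Proof.
move=> k1; elim: i => // -[|i] IH _ le; first exact: connect0.
apply: connect_trans (IH _ _) _ => //; first by lia.
apply: connect1; rewrite /adj !progression_in //; try lia; rewrite /=.
(* the common part contains the k vertices from i+2 to i+k+1 *)
have ck : #|progression n k.-1 i.+2 1| = k by rewrite card_progression //; lia.
rewrite -[leqLHS]ck; apply/subset_leq_card/subsetP => x.
by rewrite in_setI !mem_interval; lia.
Qed.

(** The bound n < 1 + 3k excludes the facets of difference 3 or more. *)
Lemma linked_vdw (n k : nat) : 1 <= k -> k < n -> n < 1 + k * 3 ->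
  n <= 2 * k \/ k <= 2 ->
  forall Fa Fb : {set 'I_n}, Fa \in facets (vdw n k) -> Fb \in facets (vdw n k) ->
  connect (adj n k) Fa Fb.
Proof.
move=> k1 kn n3 nk.
suff H F : F \in facets (vdw n k) -> connect (adj n k) (progression n k 1 1) F.
  move=> Fa Fb /H ca /H cb; apply: connect_trans cb.
  by rewrite adj_connect_sym.
move=> /(facetP _ _ _ k1) [i [d [i1 d1 le ->]]].
have [->|d2] : d = 1 \/ d = 2 by nia.
  by apply: intervals_connected => //; nia.
subst d; have k2 : k <= 2 by lia.
apply: connect_trans (intervals_connected _ _ i _ _ _) _ => //; first by lia.
apply: connect1; rewrite /adj !progression_in //; try lia; rewrite /=.
(* the common part contains i, i+2, ..., i+2(k-1), as 2(k-1) <= k *)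
have ck : #|progression n k.-1 i 2| = k by rewrite card_progression //; lia.
rewrite -[leqLHS]ck; apply: subset_leq_card; rewrite subsetI; apply/andP.
split; apply: sub_progression => m /termsP[j jk ->]; apply/termsP.
  by exists (j * 2); lia.
by exists j; lia.
Qed.

(** * Facets containing a given face *)

Lemma card_intervals_containing (n k : nat) (F : {set 'I_n}) :
  1 <= k -> n <= 2 * k -> #|F| = k ->
  #|[set G in facets (vdw n k) | F \subset G]| <= 2.
Proof.
move=> k1 n2 cF; rewrite leqNgt; apply/negP => /card_gt2P[G1 [G2 [G3 []]]].
have start G : G \in [set G in facets (vdw n k) | F \subset G] ->
    exists2 i, G = progression n k i 1 & F \subset progression n k i 1.
  rewrite in_set => /andP[/(facetP _ _ _ k1) [i [d [i1 d1 le ->]]] FG].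
  by have d_1 : d = 1 by [nia]; subst d; exists i.
have close i j : F \subset progression n k i 1 -> F \subset progression n k j 1 ->
    j <= i.+1.
  move=> Fi Fj; rewrite leqNgt; apply/negP => ij.
  by have := card_two_intervals _ _ _ _ _ k1 Fi Fj ij; rewrite cF ltnn.
move=> [/start[i1 -> F1] /start[i2 -> F2] /start[i3 -> F3]] [n12 n23 n31].
have e12 : i1 <> i2 by move=> e; rewrite e eqxx in n12.
have e23 : i2 <> i3 by move=> e; rewrite e eqxx in n23.
have e31 : i3 <> i1 by move=> e; rewrite e eqxx in n31.
have := close _ _ F1 F2; have := close _ _ F2 F1.
have := close _ _ F1 F3; have := close _ _ F3 F1.
have := close _ _ F2 F3; have := close _ _ F3 F2.
by lia.
Qed.

(** The pairs (i,d) whose progression lies in 1, ..., n and contains the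
    vertices x and y, which are numbered from 0. *)
Definition progressions_through (n k x y : nat) : seq (nat * nat) :=
  [seq p <- [seq (i, d) | i <- iota 1 n, d <- iota 1 n] |
    [&& p.1 + k * p.2 <= n, x.+1 \in terms k p.1 p.2 & y.+1 \in terms k p.1 p.2]].

Lemma card_facets_through (n k : nat) (F : {set 'I_n}) (x y : 'I_n) :
  1 <= k -> x \in F -> y \in F ->
  #|[set G in facets (vdw n k) | F \subset G]| <= size (progressions_through n k x y).
Proof.
move=> k1 xF yF.
rewrite -(size_map (fun p => progression n k p.1 p.2)).
apply: leq_trans (card_size _); apply/subset_leq_card/subsetP => G.
rewrite in_set => /andP[/(facetP _ _ _ k1) [i [d [i1 d1 le ->]]] /subsetP FG].
apply/mapP; exists (i, d) => //.
rewrite mem_filter /= le -!mem_progression !FG //=.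
by apply/allpairsP; exists (i, d); split=> //; rewrite mem_iota /=; nia.
Qed.

(** The decidable count behind the exceptional values of n: two distinct
    vertices lie together in at most two progressions and, if k = 1, so does a
    single vertex (the pairs with x = y). *)
Definition few_through (n k : nat) : bool :=
  all (fun x => all (fun y => ((k == 1) || (x != y)) ==>
    (size (progressions_through n k x y) <= 2)) (iota 0 n)) (iota 0 n).

Lemma card_facets_small (n k : nat) (F : {set 'I_n}) :
  1 <= k <= 2 -> few_through n k -> #|F| = k ->
  #|[set G in facets (vdw n k) | F \subset G]| <= 2.
Proof.
case/andP=> k1 k2 few cF.
have [x [y [xF yF xy]]] : exists x y, [/\ x \in F, y \in F & (k == 1) || (x != y)].
  have [k_1|k_1] := eqVneq k 1.
    by have /card_gt0P[x xF] : 0 < #|F| by [lia]; exists x, x.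
  by have /card_gt1P[x [y [xF yF xy]]] : 1 < #|F| by [lia]; exists x, y; rewrite xy.
apply: leq_trans (card_facets_through _ _ _ _ _ k1 xF yF) _.
move/allP/(_ x): few; rewrite mem_iota /= => /(_ (ltn_ord x)) /allP/(_ y).
by rewrite mem_iota /= => /(_ (ltn_ord y)) /implyP; apply.
Qed.

(** * The two directions *)

Lemma pseudo_manifold_vdw (n k : nat) : 1 <= k -> k < n -> n < 1 + k * 3 ->
  n <= 2 * k \/ k <= 2 /\ few_through n k -> pseudo_manifold (vdw n k).
Proof.
move=> k1 kn n3 nk; split=> [F G fF fG|F _ /eqP|Fa Fb fa fb].
- by rewrite /Defs.dim (card_facet _ _ _ k1 fF) (card_facet _ _ _ k1 fG).
- rewrite dim_ridge // => /eqP cF.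
  case: nk => [n2|[k2 few]]; first exact: card_intervals_containing.
  by apply: card_facets_small => //; rewrite k1.
- apply: connect_facets => //; apply: linked_vdw => //.
  by case: nk => [|[]]; [left|right].
Qed.

Lemma three_facets_not_pseudo_manifold (n k : nat) (F G1 G2 G3 : {set 'I_n}) :
  1 <= k -> k < n -> #|F| = k ->
  [/\ G1 \in facets (vdw n k), G2 \in facets (vdw n k) & G3 \in facets (vdw n k)] ->
  [/\ F \subset G1, F \subset G2 & F \subset G3] ->
  [/\ G1 != G2, G2 != G3 & G3 != G1] -> ~ pseudo_manifold (vdw n k).
Proof.
move=> k1 kn cF [f1 f2 f3] [s1 s2 s3] neq [_ two _].
have Fin : F \in faces (vdw n k).
  rewrite facets_vdw // in f1; rewrite inE; apply/existsP.
  by exists G1; rewrite f1.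
have /eqP dF : (Defs.dim F == complex_dim (vdw n k) - 1)%R by rewrite dim_ridge // cF.
have := two F Fin dF; rewrite leqNgt => /negP; apply.
by apply/card_gt2P; exists G1, G2, G3; split=> //; split; rewrite in_set; apply/andP.
Qed.

Lemma vdw_not_connected (n k : nat) : 3 <= k -> 2 * k < n ->
  ~ pseudo_manifold (vdw n k).
Proof.
move=> k3 n2 [_ _ conn].
have k1 : 1 <= k by lia.
have kn : k < n by lia.
have [||s [fs ps lst]] := conn (progression n k 1 1) (progression n k 1 2).
- by apply: progression_in => //; lia.
- by apply: progression_in => //; lia.
(* a facet adjacent to an interval is an interval *)
have stay i : all [in facets (vdw n k)] s ->
    path (fun G H => Defs.dim (G :&: H) == complex_dim (vdw n k) - 1)%R
      (progression n k i 1) s ->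
    exists j, last (progression n k i 1) s = progression n k j 1.
  elim: s i {fs ps lst} => [|G s IH] i /=; first by exists i.
  case/andP=> fG fs; rewrite dim_ridge // => /andP[/eqP c ps].
  have [a [d [a1 d1 le eG]]] := facetP _ _ _ k1 fG; subst G.
  have [d_1|d_1] := eqVneq d 1; first by subst d; apply: IH.
  have := card_interval_progression n k i a d k3; rewrite c ltnn; lia.
have [i e] := stay 1 fs ps.
(* the last facet would be both an interval and 1, 3, ..., 2k+1 *)
have := card_interval_progression n k i 1 2 k3 isT.
by rewrite -e lst setIid card_progression //; lia.
Qed.

Theorem corollary5p6 (n k : nat) (hk : 1 <= k) (hkn : k < n) :
  pseudo_manifold (vdw n k) <->
  [\/ k = 1 /\ (n = 2 \/ n = 3),
      k = 2 /\ [\/ n = 3, n = 4, n = 5 | n = 6]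
    | 3 <= k /\ (n <= 2 * k /\ k < n)].
Proof.
split=> [pm|].
  have [k3|k3] := leqP 3 k.
    constructor 3; split=> //; split=> //; rewrite leqNgt; apply/negP => n2.
    exact: vdw_not_connected pm.
  have [k1|k2] : k = 1 \/ k = 2 by lia.
    subst k; constructor 1; split=> //.
    suff : n <= 3 by lia.
    rewrite leqNgt; apply/negP => n4.
    apply: (three_facets_not_pseudo_manifold n 1 (progression n 0 1 1)
      (progression n 1 1 1) (progression n 1 1 2) (progression n 1 1 3)) pm => //.
    - by rewrite card_progression //; lia.
    - by split; apply: progression_in => //; lia.
    - by split; apply: sub_progression; apply/allP.
    - split; [apply: (progression_neq _ _ _ _ _ _ 2)
             |apply: (progression_neq _ _ _ _ _ _ 3)
             |apply: (progression_neq _ _ _ _ _ _ 4)] => //; lia.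
  subst k; constructor 2; split=> //.
  suff : n <= 6.
    by case: n hkn {pm} => [|[|[|[|[|[|[|n]]]]]]] //;
      [constructor 1|constructor 2|constructor 3|constructor 4].
  rewrite leqNgt; apply/negP => n7.
  apply: (three_facets_not_pseudo_manifold n 2 (progression n 1 3 2)
    (progression n 2 3 1) (progression n 2 1 2) (progression n 2 3 2)) pm => //.
  - by rewrite card_progression //; lia.
  - by split; apply: progression_in => //; lia.
  - by split; apply: sub_progression; apply/allP.
  - split; [apply: (progression_neq _ _ _ _ _ _ 4)
           |apply: (progression_neq _ _ _ _ _ _ 1)
           |apply: (progression_neq _ _ _ _ _ _ 7)] => //; lia.
case=> [[k_1 n23]|[k_2 n36]|[k3 [n2 _]]].
- subst k; apply: pseudo_manifold_vdw => //; first by lia.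
  by case: n23 => ->; [left|right].
- subst k; apply: pseudo_manifold_vdw => //; first by case: n36; lia.
  by case: n36 => ->; [left|left|right|right].
- by apply: pseudo_manifold_vdw => //; [lia|left].
Qed.
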